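(* Every weakly l-sequentially supercyclic operator on a complex Hilbert space that is similar to an isometry is similar to a unitary operator.
   Context: An operator on a Hilbert space $\mathcal X$ is a bounded linear transformation of $\mathcal X$ into itself. Two operators $T$ and $L$ are similar if $L=S^{-1}TS$ for some bounded linear bijection $S$ with bounded inverse. A unitary operator is a surjective linear isometry of a Hilbert space onto itself. A nonzero vector $y\in\mathcal X$ is weakly l-sequentially supercyclic for $T$ if for every $x\in\mathcal X$ there is a sequence of nonzero complex numbers $\{\alpha_i\}_{i\ge0}$ and a subsequence $\{T^{n_i}\}_{i\ge0}$ of $\{T^n\}_{n\ge0}$ such that $\alpha_iT^{n_i}y$ converges weakly to $x$. The operator $T$ is weakly l-sequentially supercyclic if it has such a vector. *)

(* Defs.v *)
From HB Require Import structures.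
From mathcomp Require Import all_boot all_order all_algebra complex.
From mathcomp Require Import all_classical all_reals all_analysis.

Set Implicit Arguments.
Unset Strict Implicit.
Unset Printing Implicit Defensive.

Import Order.TTheory GRing.Theory Num.Theory numFieldNormedType.Exports.
Local Open Scope classical_set_scope.
Local Open Scope ring_scope.
Local Open Scope complex_scope.

(* The norm of a normed module over [R[i]] takes its values in [R[i]].
   A [{dot H for conj}] is linear on the left, conjugate-linear on the right,
   Hermitian and positive definite. *)
HB.mixin Record NormedModule_isPreHilbert (R : realType) H
    of NormedModule R[i] H := {
  hdot : {dot H for (@Num.conj R[i])} ;
  normr_hdot : forall x : H, `|x| ^+ 2 = hdot x x
}.

#[short(type="hilbertType")]
HB.structure Definition Hilbert (R : realType) :=
  {H of CompleteNormedModule R[i] H & NormedModule_isPreHilbert R H}.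

Section Operators.
Variables (R : realType) (H : hilbertType R).
Implicit Types T L S U : {linear H -> H}.

Definition bounded_operator T : Prop := bounded_near T (nbhs (0 : H)).

Definition isometric_operator T : Prop := forall x : H, `|T x| = `|x|.

Definition unitary_operator T : Prop :=
  isometric_operator T /\ (forall y : H, exists x : H, T x = y).

Definition similar_operators T L : Prop :=
  exists S S' : {linear H -> H},
    [/\ bounded_operator S, bounded_operator S', cancel S S', cancel S' S
      & forall x : H, L x = S' (T (S x))].

Definition weakly_converges (u : nat -> H) (x : H) : Prop :=
  forall f : {linear H -> R[i]^o},
    continuous (f : H -> R[i]^o) -> f (u i) @[i --> \oo] --> (f x : R[i]^o).

Definition weakly_l_sequentially_supercyclic_vector T (y : H) : Prop :=
  y != 0 /\
  forall x : H, exists (alpha : nat -> R[i]) (n : nat -> nat),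
    [/\ forall i, alpha i != 0,
        {homo n : i j / (i < j)%N}
      & weakly_converges (fun i => alpha i *: iter (n i) T y) x].

Definition weakly_l_sequentially_supercyclic T : Prop :=
  exists y : H, weakly_l_sequentially_supercyclic_vector T y.

End Operators.

(* Main.v *)
Require Import Defs.
From mathcomp Require Import all_boot all_order all_algebra complex.
From mathcomp Require Import all_classical all_reals all_analysis.
From mathcomp Require Import ring lra.

(** The exponents n_i in the definition of weak l-sequential supercyclicity
    increase strictly, so for i >= 1 every approximant alpha_i T^(n_i) y lies in
    the range of T. A continuous functional that vanishes on the range of T
    therefore vanishes at every weak limit of approximants, that is, everywhere
    ([supercyclic_functional_eq0]): the range of T is dense.

    Let L = S^-1 T S be an isometry. Its range is closed, since a Cauchy
    sequence of values comes from a Cauchy sequence of arguments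
    ([isometric_range_closed]). If some w lay outside this range, the projection
    theorem ([exists_orthogonal]) would give z <> 0 orthogonal to it, and the
    functional x |-> <S^-1 x, z> would be continuous and kill the range of T,
    because S^-1 T = L S^-1. By density it would be zero, contradicting its
    value <z, z> at S z. Hence L is surjective, and L itself is the unitary
    operator similar to T.

    The projection theorem is proved by the classical argument: a minimizing
    sequence for the distance to a closed subspace is Cauchy by the
    parallelogram law, and the difference of w and its nearest point is
    orthogonal to the subspace because no multiple of a vector of the subspace
    can shorten it. *)

Set Implicit Arguments.
Unset Strict Implicit.
Unset Printing Implicit Defensive.

Import Order.TTheory GRing.Theory Num.Theory numFieldNormedType.Exports.
Local Open Scope classical_set_scope.
Local Open Scope ring_scope.
Local Open Scope complex_scope.

(** * Definite Hermitian forms *)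

Section DotGeometry.
Variables (C : numClosedFieldType) (U : lmodType C).
Variable form : {dot U for (@Num.conj C)}.
Implicit Types u v : U.

(** Pythagoras for the component of [u] orthogonal to [v]. The inequality of
    Cauchy and Schwarz and the orthogonality of a shortest vector
    ([hdot_eq0_min_norm]) both come from the sign of the last term. *)
Lemma dnorm_sub_proj u v : v != 0 ->
  form (u - (form u v / form v v) *: v) (u - (form u v / form v v) *: v)
    = form u u - `|form u v| ^+ 2 / form v v.
Proof.
move=> v0; have vv : form v v != 0 by rewrite dnorm_eq0.
have ov : form (u - (form u v / form v v) *: v) v = 0.
  by rewrite linearBl /= linearZl_LR /= divfK // subrr.
rewrite linearBr /= linearZr_LR /= ov mulr0 subr0 linearBl /= linearZl_LR /=.
by rewrite (hermC _ v u) /= expr0 mul1r mulrAC -normCK.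
Qed.

Lemma dnorm_parallelogram u v :
  form (u + v) (u + v) + form (u - v) (u - v) = 2 * (form u u + form v v).
Proof. by rewrite dnormD dnormB; ring. Qed.

End DotGeometry.

(** * The projection theorem *)

Section HilbertGeometry.
Variables (R : realType) (H : hilbertType R).
Implicit Types (u v w x y z : H) (M : set H).

Lemma sqr_norm_sub_proj z v : v != 0 ->
  `|z - (hdot z v / hdot v v) *: v| ^+ 2
    = `|z| ^+ 2 - `|hdot z v| ^+ 2 / hdot v v.
Proof. by move=> v0; rewrite !normr_hdot; exact: dnorm_sub_proj. Qed.

Lemma normr_hdot_le x z : `|hdot x z| <= `|z| * `|x|.
Proof.
have [->|z0] := eqVneq z 0; first by rewrite linear0r !normr0 mul0r.
have zz : 0 < hdot z z by rewrite dnorm_gt0.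
have : 0 <= `|x - (hdot x z / hdot z z) *: z| ^+ 2 by rewrite exprn_ge0.
rewrite sqr_norm_sub_proj // subr_ge0 ler_pdivrMr // -normr_hdot mulrC -exprMn.
by rewrite ler_sqr // nnegrE ?mulr_ge0.
Qed.

Lemma continuous_hdotl z : continuous (applyr hdot z : H -> R[i]^o).
Proof.
apply: (@bounded_linear_continuous _ _ _
  (applyr hdot z : {linear H -> R[i]^o})).
apply/linear_boundedP; near=> r => x /=.
apply: le_trans (normr_hdot_le x z) _; apply: ler_wpM2r; first by [].
by near: r; apply: nbhs_pinfty_ge; exact: normr_real.
Unshelve. all: end_near. Qed.

(** Subtracting from [z] its projection onto [v] shortens it by an amount that
    is zero only when the two vectors are orthogonal. *)
Lemma hdot_eq0_min_norm z v :
  (forall a : R[i], `|z| <= `|z - a *: v|) -> hdot z v = 0.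
Proof.
move=> zmin; have [->|v0] := eqVneq v 0; first by rewrite linear0r.
have vv : 0 < hdot v v by rewrite dnorm_gt0.
have := zmin (hdot z v / hdot v v).
rewrite -ler_sqr ?nnegrE // sqr_norm_sub_proj // lerDl oppr_ge0.
rewrite pmulr_lle0 ?invr_gt0 // => h.
have : `|hdot z v| ^+ 2 == 0 by rewrite eq_le h exprn_ge0.
by rewrite expf_eq0 normr_eq0 => /eqP.
Qed.

(** The norm takes its values in [R[i]], which has neither a total order nor
    infima; distances to a set are therefore minimized over its real copy. *)
Definition rnorm x : R := complex.Re `|x|.

Lemma rnormE x : `|x| = (rnorm x)%:C.
Proof. by rewrite /rnorm RRe_real // normr_real. Qed.

Lemma rnorm_ge0 x : 0 <= rnorm x.
Proof. by rewrite -ler0c -rnormE. Qed.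

Lemma parallelogram x y :
  rnorm (x + y) ^+ 2 + rnorm (x - y) ^+ 2 = 2 * (rnorm x ^+ 2 + rnorm y ^+ 2).
Proof.
apply: (@complexI R).
rewrite rmorphD [RHS]rmorphM rmorph_nat rmorphD !rmorphXn /=.
rewrite -!rnormE !normr_hdot; exact: dnorm_parallelogram.
Qed.

Lemma cvg_rnormP (s : nat -> H) x :
  (s n @[n --> \oo] --> x) <->
  (forall e : R, 0 < e -> \forall n \near \oo, rnorm (x - s n) < e).
Proof.
split=> [sx e e0|sx].
  move/cvgrPdist_lt : sx => /(_ e%:C); rewrite ltcR => /(_ e0).
  by apply: filterS => n; rewrite rnormE ltcR.
apply/cvgrPdist_lt => e e0.
have eE : (complex.Re e)%:C = e by rewrite RRe_real // gtr0_real.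
have /sx : 0 < complex.Re e by rewrite -ltcR eE.
by apply: filterS => n; rewrite rnormE -{2}eE ltcR.
Qed.

Lemma cauchy_rnorm_cvg (s : nat -> H) :
  (forall e : R, 0 < e ->
     exists m : nat, \forall n \near \oo, rnorm (s m - s n) < e) ->
  exists x : H, s n @[n --> \oo] --> x.
Proof.
move=> sC; suff : cvg (s n @[n --> \oo]).
  by move=> h; exists (lim (s n @[n --> \oo])).
apply: cauchy_cvg; apply: cauchy_exP => e e0.
have eE : (complex.Re e)%:C = e by rewrite RRe_real // gtr0_real.
have /sC[m hm] : 0 < complex.Re e by rewrite -ltcR eE.
exists (s m); apply: filterS hm => n.
by rewrite -ball_normE /= rnormE -{2}eE ltcR.
Qed.

Definition seq_closed M := forall (s : nat -> H) x,
  (forall n, M (s n)) -> s n @[n --> \oo] --> x -> M x.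

Definition subspace M :=
  [/\ M 0, forall x y, M x -> M y -> M (x + y)
    & forall (a : R[i]) x, M x -> M (a *: x)].

(** Two points of [M] whose distances to [w] are almost minimal are close to
    each other: their midpoint is in [M], hence not nearer to [w] than the
    infimum, and the parallelogram law bounds their distance. A minimizing
    sequence is thus Cauchy, and its limit is the nearest point. *)
Lemma exists_nearest M w : subspace M -> seq_closed M ->
  exists2 m, M m & forall x, M x -> `|w - m| <= `|w - x|.
Proof.
move=> [M0 MD MZ] Mcl.
pose D := [set rnorm (w - x) | x in M]; pose d := inf D.
have Dinf : has_inf D.
  split; first by exists (rnorm (w - 0)), 0.
  by exists 0 => _ [x _ <-]; exact: rnorm_ge0.
have dle x : M x -> d <= rnorm (w - x).
  by move=> Mx; apply: ge_inf; [exact: Dinf.2 | exists x].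
have d0 : 0 <= d.
  by apply: lb_le_inf; [exact: Dinf.1 | move=> _ [x _ <-]; exact: rnorm_ge0].
have /choice[s sP] n : exists x, M x /\ rnorm (w - x) < d + n.+1%:R^-1.
  have [|_ [x Mx <-] h] := @inf_adherent _ D n.+1%:R^-1 _ Dinf.
    by rewrite invr_gt0.
  by exists x.
have near_le e : 0 < e -> \forall n \near \oo, rnorm (w - s n) < d + e.
  move=> e0; near=> n; apply: lt_trans (sP n).2 _; rewrite ltrD2l.
  by near: n; exact: near_infty_natSinv_lt (PosNum e0).
(* The bound is 4 (d + e)^2 - 4 d^2. *)
have close x y e : M x -> M y ->
    rnorm (w - x) < d + e -> rnorm (w - y) < d + e ->
    0 <= e -> rnorm (x - y) ^+ 2 <= 8 * d * e + 4 * e ^+ 2.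
  move=> Mx My hx hy e0.
  have := parallelogram (w - y) (w - x).
  have -> : (w - y) - (w - x) = x - y by rewrite opprB addrC addrA subrK.
  have -> : (w - y) + (w - x) = 2 *: (w - 2^-1 *: (x + y)).
    rewrite scalerBr scalerA divff ?pnatr_eq0 // scale1r scaler_nat mulr2n.
    by rewrite opprD addrACA [- x - y]addrC.
  have -> v : rnorm (2 *: v) = 2 * rnorm v.
    apply: (@complexI R); rewrite rmorphM /= -!rnormE normrZ normr_nat.
    by rewrite rmorph_nat.
  have := dle _ (MZ 2^-1 _ (MD _ _ Mx My)).
  have := rnorm_ge0 (w - x); have := rnorm_ge0 (w - y).
  set a := rnorm (w - y) in hy *; set b := rnorm (w - x) in hx *.
  set c := rnorm (w - _); set f := rnorm (x - y) => a0 b0 dc E.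
  have : a ^+ 2 <= (d + e) ^+ 2 by rewrite ler_sqr ?nnegrE; lra.
  have : b ^+ 2 <= (d + e) ^+ 2 by rewrite ler_sqr ?nnegrE; lra.
  have : d ^+ 2 <= c ^+ 2 by rewrite ler_sqr ?nnegrE; lra.
  have -> : f ^+ 2 = 2 * (a ^+ 2 + b ^+ 2) - (2 * c) ^+ 2 by rewrite -E; ring.
  by move=> h1 h2 h3; rewrite exprMn; nra.
have [m sm] : exists m : H, s n @[n --> \oo] --> m.
  apply: cauchy_rnorm_cvg => e e0.
  (* As r <= 1, the bound 8 d r + 4 r^2 is less than r (8 d + 8) <= e^2. *)
  pose r := Num.min 1 (e ^+ 2 / (8 * d + 8)).
  have D0 : 0 < 8 * d + 8 by lra.
  have r0 : 0 < r by rewrite lt_min ltr01 divr_gt0 // exprn_gt0.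
  have [N _ hN] := near_le r r0.
  exists N; exists N => // n /= Nn.
  have h := close _ _ r (sP N).1 (sP n).1 (hN N (leqnn N)) (hN n Nn) (ltW r0).
  rewrite -ltr_sqr ?nnegrE ?rnorm_ge0 ?(ltW e0) //; apply: le_lt_trans h _.
  have r1 : r <= 1 by rewrite ge_min lexx.
  have : r * (8 * d + 8) <= e ^+ 2 by rewrite -ler_pdivlMr // ge_min lexx orbT.
  nra.
have Mm : M m by apply: Mcl sm => n; exact: (sP n).1.
exists m => // x Mx; rewrite !rnormE lecR; apply: le_trans (dle x Mx).
apply/ler_addgt0Pr => e e0.
have e2 : 0 < e / 2 by rewrite divr_gt0.
near \oo => n.
have h1 : rnorm (w - s n) < d + e / 2 by near: n; exact: near_le.
have h2 : rnorm (m - s n) < e / 2 by near: n; exact: (cvg_rnormP s m).1.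
have : rnorm (w - m) <= rnorm (w - s n) + rnorm (m - s n).
  by rewrite -lecR rmorphD /= -!rnormE (distrC m); exact: ler_distD.
lra.
Unshelve. all: end_near. Qed.

Lemma exists_orthogonal M w : subspace M -> seq_closed M -> ~ M w ->
  exists2 z, z != 0 & forall x, M x -> hdot x z = 0.
Proof.
move=> Msub Mcl Mw; have [m Mm mmin] := exists_nearest w Msub Mcl.
case: Msub => _ MD MZ.
exists (w - m); first by apply: contra_notN Mw; rewrite subr_eq0 => /eqP ->.
move=> x Mx; suff h : hdot (w - m) x = 0.
  by rewrite hermC /= h rmorph0 mulr0.
apply: hdot_eq0_min_norm => a; rewrite -addrA -opprD.
by apply: mmin; apply: MD => //; exact: MZ.
Qed.

(** * Ranges of isometries and of supercyclic operators *)

Lemma subspace_range (L : {linear H -> H}) : subspace (range L).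
Proof.
split=> [|_ _ [x _ <-] [y _ <-]|a _ [x _ <-]].
- by exists 0; rewrite ?linear0.
- by exists (x + y); rewrite ?linearD.
- by exists (a *: x); rewrite ?linearZ.
Qed.

(** If the values [L (t n)] converge they are Cauchy, hence so are the [t n],
    which have the same mutual distances; [L] maps their limit to the limit of
    the values. *)
Lemma isometric_range_closed (L : {linear H -> H}) :
  isometric_operator L -> seq_closed (range L).
Proof.
move=> isoL s y sL sy.
have rL x : rnorm (L x) = rnorm x by rewrite /rnorm isoL.
have [t tP] := choice (fun n => let: ex_intro2 x _ e := sL n in ex_intro _ x e).
have [x tx] : exists x : H, t n @[n --> \oo] --> x.
  apply: cauchy_rnorm_cvg => e e0.
  have e2 : 0 < e / 2 by rewrite divr_gt0.
  have [N _ hN] := (cvg_rnormP s y).1 sy _ e2.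
  exists N; exists N => // n /= Nn.
  rewrite -rL linearB !tP -ltcR -rnormE.
  apply: le_lt_trans (ler_distD y _ _) _.
  rewrite (distrC (s N)) !rnormE -rmorphD ltcR.
  have := hN N (leqnn N); have := hN n Nn; rewrite /=; lra.
exists x => //.
apply: (cvg_unique (@norm_hausdorff _ H) (F := s n @[n --> \oo])) => //.
apply/cvg_rnormP => e e0; move/cvg_rnormP : tx => /(_ e e0).
by apply: filterS => n; rewrite -tP -linearB rL.
Qed.

(** Only finitely many terms of a weakly convergent sequence
    [alpha i *: iter (n i) T y] can lie outside the range of [T], as [n] is
    strictly increasing; so [f] is eventually zero along it. *)
Lemma supercyclic_functional_eq0 (T : {linear H -> H})
    (f : {linear H -> R[i]^o}) :
  weakly_l_sequentially_supercyclic T -> continuous (f : H -> R[i]^o) ->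
  (forall x, f (T x) = 0) -> forall x, f x = 0.
Proof.
move=> [y [_ Ty]] fC fT x; have [alpha [n [_ n_incr wc]]] := Ty x.
apply: (cvg_unique (@norm_hausdorff _ R[i]^o)
  (F := f (alpha i *: iter (n i) T y) @[i --> \oo]));
  first exact: wc.
apply: cvg_near_cst; exists 1%N => // i /= i0.
have : (0 < n i)%N by apply: leq_ltn_trans (leq0n (n 0%N)) (n_incr _ _ i0).
by case: (n i) => // k _; rewrite iterS linearZ /= fT scaler0.
Qed.

End HilbertGeometry.

Theorem corollary4p3 (R : realType) (H : hilbertType R) (T : {linear H -> H}) :
  bounded_operator T ->
  weakly_l_sequentially_supercyclic T ->
  (exists L : {linear H -> H}, isometric_operator L /\ similar_operators T L) ->
  exists U : {linear H -> H}, unitary_operator U /\ similar_operators T U.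
Proof.
move=> _ Tsc [L [isoL simL]]; exists L; split=> //; split=> // w.
apply: contrapT => Lw.
have [z z0 zL] : exists2 z, z != 0 & forall x, range L x -> hdot x z = 0.
  apply: (@exists_orthogonal _ _ _ w); first exact: subspace_range.
    exact: isometric_range_closed.
  by case=> x _ Lx; apply: Lw; exists x.
case: simL => S [S' [_ bS' SK S'K LE]].
pose f : {linear H -> R[i]^o} := (applyr hdot z : {linear H -> R[i]^o}) \o S'.
have fC : continuous (f : H -> R[i]^o).
  move=> x; apply: continuous_comp; last exact: continuous_hdotl.
  exact: bounded_linear_continuous.
(* S^-1 (T x) = L (S^-1 x) lies in the range of L. *)
have fT x : f (T x) = 0.
  by rewrite /f /= -(S'K x) -LE; apply: zL; exists (S' x).
have := supercyclic_functional_eq0 Tsc fC fT (S z).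
by rewrite /f /= SK => /eqP; rewrite dnorm_eq0 (negPf z0).
Qed.
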